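(* Let $\alpha>0$ and $(a,b)\in\mathbb{R}^2$ with $a<b$. Then $S_a^\alpha$ is a linear and continuous operator from $L^1([a,b];\mathbb{R})$ to $L^1([a,b];\mathbb{R})$. Moreover, $$\left\|S_a^\alpha f\right\|_{L^1([a,b];\mathbb{R})}\leq \alpha\left(\int_0^\infty P\left(s,\frac{b-a}{\alpha}\right)\,ds\right)\|f\|_{L^1([a,b];\mathbb{R})},\quad f\in L^1([a,b];\mathbb{R}).$$
   Context: Let $\mathcal{S}(t)=e^{-t}\int_0^\infty \frac{t^{s-1}}{\Gamma(s)}\,ds$ for $t>0$, where $\Gamma$ is the Gamma function. For $\alpha>0$, $a<b$ real and $f\in L^1([a,b];\mathbb{R})$, the left-sided fractional integral of second kind of order $\alpha$ of $f$ is $$(S_a^\alpha f)(x)=\int_a^x \mathcal{S}\left(\frac{x-t}{\alpha}\right)f(t)\,dt\quad\text{for a.e. } x\in[a,b].$$ The regularized lower Gamma function is $P(s,x)=\frac{1}{\Gamma(s)}\int_0^x t^{s-1}e^{-t}\,dt$ for $s>0$, $x>0$. *)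

(* Defs.v *)
From HB Require Import structures.
From mathcomp Require Import all_boot all_order all_algebra.
From mathcomp Require Import all_classical all_reals all_analysis.
From mathcomp Require Import measurable_realfun ess_sup_inf.

Set Implicit Arguments.
Unset Strict Implicit.
Unset Printing Implicit Defensive.

Import Order.TTheory GRing.Theory Num.Theory.
Import numFieldNormedType.Exports.

Local Open Scope classical_set_scope.
Local Open Scope ring_scope.

Lemma filterS4 T (F : set_system T) {FF : Filter F} (P Q R S U : set T) :
  (forall x, P x -> Q x -> R x -> S x -> U x) ->
  F P -> F Q -> F R -> F S -> F U.
Proof.
move=> PQRSU FP FQ FR FS; apply: filterS3 (filterI FP FQ) FR FS.
by move=> x [Px Qx]; exact: PQRSU.
Qed.

(* The library has the type [LspaceType mu p1] of a.e. classes of functions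
   with finite Lp-norm, but no algebraic or topological structure on it. The
   instances below make it a normed module over R, the operations being those
   of representatives. *)
Section Lspace_normedModType.
Context d (T : measurableType d) (R : realType).
Variables (mu : {measure set T -> \bar R}) (p : \bar R) (p1 : (1 <= p)%E).
Local Notation lfun := (LfunType mu p1).
Local Notation lspace := (LspaceType mu p1).

Lemma eq_ae_Lnorm (f g : T -> R) : measurable_fun setT f ->
  measurable_fun setT g -> f = g %[ae mu] ->
  'N[mu]_p[EFin \o f]%E = 'N[mu]_p[EFin \o g]%E.
Proof.
move=> mf mg fg; rewrite unlock /Lnorm; case: p p1 => //= [r _|_].
  congr (_ `^ _)%E; apply: ae_eq_integral => //.
  - apply/measurable_EFinP.
    apply: (measurableT_comp (measurable_powR _)).
    exact: measurableT_comp.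
  - apply/measurable_EFinP.
    apply: (measurableT_comp (measurable_powR _)).
    exact: measurableT_comp.
  - by apply: filterS fg => x /(_ I) fgx _ /=; rewrite fgx.
case: ifPn => // _; apply: eq_ess_sup.
by apply: filterS fg => x /(_ I) /= ->.
Qed.

Lemma Lspace_Lfun (F : lspace) : (F : T -> R) \in Lfun mu p.
Proof.
apply/andP; split; rewrite inE/=; last exact: Lebesgue_finite.
exact: (@measurable_funPT _ _ _ _ (repr (F : {mfun_ mu, T >-> _}))).
Qed.

Definition Lfun_of_Lspace (F : lspace) : lfun := Lfun_Sub p1 (Lspace_Lfun F).

(* [{mfun T >-> R}] and [{mfun T >-> measurableTypeR R}] have the same elements
   but are not convertible: the Borel sigma-algebra of [measurableTypeR R]
   bears another display. *)
Lemma measurable_fun_Borel (f : lfun) :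
  measurable_fun setT (f : T -> measurableTypeR R).
Proof. exact: (@measurable_funPT _ _ _ _ (f : {mfun T >-> R})). Qed.

Definition mfun_of_Lfun (f : lfun) : {mfun T >-> measurableTypeR R} :=
  HB.pack (f : T -> measurableTypeR R)
    (isMeasurableFun.Build _ _ T (measurableTypeR R) f (measurable_fun_Borel f)).

Definition mfun_class (f : lfun) : {mfun_ mu, T >-> measurableTypeR R} :=
  (\pi_({mfun_ mu, T >-> measurableTypeR R}) (mfun_of_Lfun f))%qT.

Lemma mfun_classE (f : lfun) : (mfun_class f : T -> R) = f %[ae mu].
Proof.
have /eqP := reprK (mfun_class f); rewrite /mfun_class.
by rewrite eqmodE => /asboolP.
Qed.

Lemma mfun_class_finite (f : lfun) : finite_norm mu p (mfun_class f).
Proof.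
rewrite /finite_norm (@eq_ae_Lnorm _ f)//.
- exact: Lfunction_finite.
- exact: (@measurable_funPT _ _ _ _ (repr (mfun_class f))).
- exact: mfun_classE.
Qed.

Definition Lspace_class (f : lfun) : lspace :=
  HB.pack_for lspace (mfun_class f)
    (isFinLebesgue.Build d T R mu p p1 (mfun_class f) (mfun_class_finite f)).

Lemma Lspace_classE (f : lfun) : (Lspace_class f : T -> R) = f %[ae mu].
Proof. exact: mfun_classE. Qed.

Lemma LspaceP (F G : lspace) : (F : T -> R) = G %[ae mu] -> F = G.
Proof.
case: F => F [[iF]]; case: G => G [[iG]] /= FG.
have E : F = G.
  by rewrite -[F]reprK -[G]reprK; apply/eqP; rewrite eqmodE; apply/asboolP.
by subst G; congr LebesgueSpace.Pack; congr LebesgueSpace.Class;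
  congr isFinLebesgue.Axioms_; exact: Prop_irrelevance.
Qed.

Local Notation "\cl f" := (Lspace_class f) (at level 8).
Local Notation rp := Lfun_of_Lspace.

Definition Lspace_add (F G : lspace) := \cl (rp F + rp G).
Definition Lspace_opp (F : lspace) := \cl (- rp F).
Definition Lspace_scale (c : R) (F : lspace) := \cl (c *: rp F).

Lemma Lspace_addE F G :
  (Lspace_add F G : T -> R) = (F : T -> R) \+ G %[ae mu].
Proof. exact: Lspace_classE. Qed.

Lemma Lspace_oppE F : (Lspace_opp F : T -> R) = \- (F : T -> R) %[ae mu].
Proof. exact: Lspace_classE. Qed.

Lemma Lspace_scaleE c F :
  (Lspace_scale c F : T -> R) = c \*: (F : T -> R) %[ae mu].
Proof. exact: Lspace_classE. Qed.

Lemma Lspace_zeroE : (\cl 0 : T -> R) = cst 0 %[ae mu].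
Proof. exact: Lspace_classE. Qed.

HB.instance Definition _ := gen_eqMixin lspace.
HB.instance Definition _ := gen_choiceMixin lspace.

Lemma Lspace_addA : associative Lspace_add.
Proof.
move=> F G H; apply: LspaceP.
have := Lspace_addE F (Lspace_add G H); have := Lspace_addE G H.
have := Lspace_addE (Lspace_add F G) H; have := Lspace_addE F G.
apply: filterS4 => x h1 h2 h3 h4 _; rewrite h4// h2//= h3//= h1//=.
by rewrite addrA.
Qed.

Lemma Lspace_addC : commutative Lspace_add.
Proof.
move=> F G; apply: LspaceP.
have := Lspace_addE F G; have := Lspace_addE G F.
by apply: filterS2 => x h1 h2 _; rewrite h1// h2//= addrC.
Qed.

Lemma Lspace_add0 : left_id (\cl 0) Lspace_add.
Proof.
move=> F; apply: LspaceP.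
have := Lspace_addE (\cl 0) F; have := Lspace_zeroE.
by apply: filterS2 => x h1 h2 _; rewrite h2//= h1//= add0r.
Qed.

Lemma Lspace_addN : left_inverse (\cl 0) Lspace_opp Lspace_add.
Proof.
move=> F; apply: LspaceP.
have := Lspace_addE (Lspace_opp F) F; have := Lspace_oppE F.
have := Lspace_zeroE.
by apply: filterS3 => x h1 h2 h3 _; rewrite h3//= h2//= h1//= addNr.
Qed.

HB.instance Definition _ := GRing.isZmodule.Build lspace
  Lspace_addA Lspace_addC Lspace_add0 Lspace_addN.

Lemma Lspace_scaleA a b F :
  Lspace_scale a (Lspace_scale b F) = Lspace_scale (a * b) F.
Proof.
apply: LspaceP.
have := Lspace_scaleE a (Lspace_scale b F); have := Lspace_scaleE b F.
have := Lspace_scaleE (a * b) F.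
by apply: filterS3 => x h1 h2 h3 _; rewrite h3//= h2//= h1//= scalerA.
Qed.

Lemma Lspace_scale1 : left_id 1 Lspace_scale.
Proof.
move=> F; apply: LspaceP; have := Lspace_scaleE 1 F.
by apply: filterS => x h1 _; rewrite h1//= scale1r.
Qed.

Lemma Lspace_scaleDr : right_distributive Lspace_scale +%R.
Proof.
move=> c F G; apply: LspaceP.
apply: (filterS4 _ (filterI (Lspace_scaleE c F) (Lspace_scaleE c G))
  (Lspace_addE (Lspace_scale c F) (Lspace_scale c G)) (Lspace_addE F G)
  (Lspace_scaleE c (F + G))) => x [h1 h2] h3 h4 h5 _.
by rewrite h5//= h3//= h4//= h1//= h2//= scalerDr.
Qed.

Lemma Lspace_scaleDl F : {morph Lspace_scale^~ F : a b / a + b}.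
Proof.
move=> a b; apply: LspaceP.
have := Lspace_scaleE (a + b) F.
have := Lspace_addE (Lspace_scale a F) (Lspace_scale b F).
have := Lspace_scaleE a F; have := Lspace_scaleE b F.
apply: filterS4 => x h1 h2 h3 h4 _.
by rewrite h4//= h3//= h2//= h1//= scalerDl.
Qed.

HB.instance Definition _ := GRing.Zmodule_isLmodule.Build R lspace
  Lspace_scaleA Lspace_scale1 Lspace_scaleDr Lspace_scaleDl.

Definition Lspace_norm (F : lspace) : R :=
  fine 'N[mu]_p[EFin \o (F : T -> R)]%E.

Lemma Lspace_norm_class (f : lfun) :
  Lspace_norm (\cl f) = fine 'N[mu]_p[EFin \o f]%E.
Proof.
congr fine; apply: eq_ae_Lnorm => //; last exact: Lspace_classE.
exact: (@measurable_funPT _ _ _ _ (rp (\cl f) : {mfun T >-> R})).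
Qed.

Lemma Lspace_normD F G :
  Lspace_norm (F + G) <= Lspace_norm F + Lspace_norm G.
Proof. by rewrite Lspace_norm_class; exact: (ler_LnormD (rp F) (rp G)). Qed.

Lemma Lspace_normZ c F : Lspace_norm (c *: F) = `|c| * Lspace_norm F.
Proof.
rewrite Lspace_norm_class; apply: EFin_inj.
rewrite finite_norm_fine EFinM /Lspace_norm.
by rewrite (finite_norm_fine (rp F)) -LnormZ.
Qed.

Lemma Lspace_norm0_eq0 F : Lspace_norm F = 0 -> F = 0.
Proof.
move=> /(@fine_Lnormr_eq0 _ _ _ _ _ _ (rp F)) F0; apply: LspaceP.
by apply: filterS2 F0 Lspace_zeroE => x h1 h2 _; rewrite h2//; exact: h1.
Qed.

HB.instance Definition _ := Lmodule_isNormed.Build R lspace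
  Lspace_normD Lspace_normZ Lspace_norm0_eq0.

End Lspace_normedModType.

Section special_functions.
Variable R : realType.
Local Notation mu := (@lebesgue_measure R).

Definition Gamma (s : R) : R :=
  \int[mu]_(t in `]0, +oo[) (t `^ (s - 1) * expR (- t)).

Definition regularized_lower_Gamma (s x : R) : R :=
  (Gamma s)^-1 * \int[mu]_(t in `]0, x[) (t `^ (s - 1) * expR (- t)).

Definition kernel_second_kind (t : R) : R :=
  expR (- t) * \int[mu]_(s in `]0, +oo[) (t `^ (s - 1) / Gamma s).

(* The argument of [kernel_second_kind] must be positive, hence the interval
   open at x. *)
Definition left_integrand (alpha : R) (f : R -> R) (x t : R) : R :=
  kernel_second_kind ((x - t) / alpha) * f t.

Definition left_fractional_integral (alpha a : R) (f : R -> R) (x : R) : R :=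
  \int[mu]_(t in `[a, x[) left_integrand alpha f x t.

End special_functions.

(* L^1([a, b]; R): functions on the whole line modulo equality almost
   everywhere on [a, b], for the Lebesgue measure restricted to [a, b]. *)
Definition L1 (R : realType) (a b : R) : normedModType R :=
  LspaceType (mrestr (@lebesgue_measure R) (measurable_itv `[a, b]))
    (@lexx _ _ 1%E).

(* Main.v *)
(* The operator is the convolution of f, cut off to [a, b], with the kernel
   u |-> S(u / alpha), cut off to 0 < u <= b - a, so Young's inequality for L^1
   bounds its norm by alpha times the integral of S over 0 < u <= M, where
   M = (b - a) / alpha. By Tonelli's theorem that integral is the integral over
   s of P(s, M). It is finite because P(s, M) <= 1 and, for s >= 1, comparing
   the Gamma integrand just above e M with its values below M gives
   P(s, M) = O(exp(-s)). *)
From HB Require Import structures.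
Require Import Defs.
From mathcomp Require Import all_boot all_order all_algebra.
From mathcomp Require Import all_classical all_reals all_analysis.
From mathcomp Require Import measurable_realfun exponential_distribution.
From mathcomp Require Import ring.
Import Order.TTheory GRing.Theory Num.Theory.
Import numFieldNormedType.Exports.
Local Open Scope classical_set_scope.
Local Open Scope ring_scope.

(** * Integrals and null sets for a restricted measure *)

Section mrestr_theory.
Context d (T : measurableType d) (R : realType).
Variables (mu : {measure set T -> \bar R}) (D : set T) (mD : measurable D).
Local Notation muD := (mrestr mu mD : {measure set T -> \bar R}).

(** The complement of [D] is null for the restricted measure, and on subsets of [D] the two measures
    agree. *)
Lemma ge0_integral_mrestr (f : T -> \bar R) : measurable_fun setT f ->
  (forall x, 0 <= f x)%E ->
  (\int[muD]_x f x = \int[mu]_(x in D) f x)%E.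
Proof.
move=> mf f0; rewrite -(setUv D) ge0_integral_setU//=.
- rewrite (null_set_integral (measurableC mD)) ?adde0//.
  + apply: eq_measure_integral => A mA AD.
    by rewrite /= /mrestr setIidl.
  + exact: measurable_funTS.
  + by rewrite /= /mrestr setICl measure0.
- exact: measurableC.
- by rewrite setUv.
- exact/disj_setPCl.
Qed.

Lemma integrable_mrestr (f : T -> \bar R) : measurable_fun setT f ->
  muD.-integrable setT f <-> mu.-integrable D f.
Proof.
move=> mf; have mf' : measurable_fun D f by exact: measurable_funTS.
have E : (\int[muD]_x `|f x| = \int[mu]_(x in D) `|f x|)%E.
  by apply: ge0_integral_mrestr => //; exact: measurableT_comp.
by split => /integrableP[_ fi]; apply/integrableP; split => //;
  [rewrite -E|rewrite E].
Qed.

Lemma ae_mrestr (P : T -> Prop) :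
  {ae muD, forall x, P x} <-> {ae mu, forall x, D x -> P x}.
Proof.
split=> -[A [mA A0 PA]].
- exists (A `&` D); split => //; first exact: measurableI.
  move=> x /= nP; split; last by apply: contrapT => nD; exact: nP.
  by apply: PA => /= Px; exact: nP.
(* Outside [D] nothing is known about [P], so the exceptional set has to absorb [~ D], which is null
   for the restricted measure. *)
- exists (A `|` ~` D); split; first exact: measurableU (measurableC mD).
    apply/eqP; rewrite /= /mrestr setIUl setICl setU0 -measure_le0 -A0.
    by apply: le_measure; rewrite ?inE//; exact: measurableI.
  move=> x /= nP; have [Dx|] := pselect (D x); last by right.
  by left; apply: PA => /= /(_ Dx).
Qed.

End mrestr_theory.

(** * Affine change of variable *)

Section affine_substitution.
Context {R : realType}.
Local Notation mu := (@lebesgue_measure R).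
Local Open Scope ereal_scope.

Lemma ge0_integral_affine (c t : R) (f : R -> \bar R) : (0 < c)%R ->
  measurable_fun setT f -> (forall x, 0 <= f x) ->
  \int[mu]_x f ((x - t) / c)%R = c%:E * \int[mu]_x f x.
Proof.
move=> c0 mf f0.
pose phi (x : measurableTypeR R) : measurableTypeR R := ((x - t) / c)%R.
have mphi : measurable_fun setT phi.
  by apply: measurable_funM => //; exact: measurable_funB.
have ci0 : (0 <= c^-1)%R by rewrite invr_ge0 ltW.
(* Lebesgue measure is determined by its values on half-open intervals. The preimage of []u, v]]
   under [phi] is []c u + t, c v + t]], which is [c] times as long; the factor [c^-1]
   compensates. *)
have E A : measurable A ->
    mu A = mscale (NngNum ci0) (pushforward mu phi) A.
  apply: lebesgue_measure_unique => _ [[u v]] _ <-.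
  rewrite /= /mscale/= /pushforward.
  have -> : phi @^-1` `]u, v] = `](c * u + t)%R, (c * v + t)%R]%classic.
    apply/seteqP; split => x /=;
      rewrite !in_itv/= /phi ltr_pdivlMr// ler_pdivrMr//;
      by rewrite ltrBrDr lerBlDr ![(c * _)%R]mulrC.
  rewrite !lebesgue_measure_itv/= !lte_fin ltrD2r ltr_pM2l//.
  case: ifPn => _; last by rewrite mule0.
  rewrite -EFinB -EFinB -EFinM; congr EFin.
  by rewrite opprD addrACA subrr addr0 -mulrBr mulKf// gt_eqF.
rewrite [in RHS](eq_measure_integral
  (mscale (NngNum ci0) (pushforward mu phi))); last first.
  by move=> A mA _; exact: E.
rewrite ge0_integral_mscale// ge0_integral_pushforward//= preimage_setT.
by rewrite muleA -EFinM divff ?gt_eqF// mul1e.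
Qed.

End affine_substitution.

(** * Convolution in L^1 and Young's inequality *)

Section convolution.
Context {R : realType}.
Local Notation mu := (@lebesgue_measure R).
Variables k f : R -> R.
Hypotheses (mk : measurable_fun setT k) (mf : measurable_fun setT f).

Lemma measurable_convolution_integrand :
  measurable_fun setT
    (fun z : measurableTypeR R * measurableTypeR R => k (z.1 - z.2) * f z.2).
Proof.
apply: measurable_funM.
  apply: (measurableT_comp mk).
  by apply: measurable_funB; [exact: measurable_fst|exact: measurable_snd].
by apply: (measurableT_comp mf); exact: measurable_snd.
Qed.

(** With [t] fixed, translation invariance turns the inner integral over [x] into [|f t|] times the
    norm of [k], a constant that then leaves the outer integral. *)
Lemma convolution_tonelli :
  (\int[mu]_t \int[mu]_x `|(k (x - t) * f t)%:E| =
   (\int[mu]_x `|(k x)%:E|) * (\int[mu]_x `|(f x)%:E|))%E.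
Proof.
have mk' : measurable_fun setT (fun x => `|(k x)%:E|%E).
  by apply: measurableT_comp => //; exact/measurable_EFinP.
have mf' : measurable_fun setT (fun x => `|(f x)%:E|%E).
  by apply: measurableT_comp => //; exact/measurable_EFinP.
rewrite -ge0_integralZl//; last exact: integral_ge0.
apply: eq_integral => t _.
under eq_integral do rewrite EFinM abseM muleC.
rewrite ge0_integralZl//=.
(* Scale [1] in the affine substitution is translation invariance. *)
- have := @ge0_integral_affine R 1 t (fun x => `|(k x)%:E|%E) ltr01 mk'.
  under eq_integral do rewrite divr1.
  by move=> -> //; rewrite mul1e muleC.
- apply: (measurableT_comp mk'
    (_ : measurable_fun [set: measurableTypeR R] (fun x : R => x - t))).
  exact: measurable_funB.
Qed.

Hypotheses (ik : mu.-integrable setT (EFin \o k))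
  (jf : mu.-integrable setT (EFin \o f)).

Let mule_L1_lty :
  ((\int[mu]_x `|(k x)%:E|) * (\int[mu]_x `|(f x)%:E|) < +oo)%E.
Proof.
case/integrableP: ik => _ k_lty; case/integrableP: jf => _ f_lty.
by apply: lte_mul_pinfty => //; rewrite ?ge0_fin_numE// integral_ge0.
Qed.

(** One finite iterated integral of the absolute value suffices. Fubini's theorem then gives both
    the measurability of the convolution and the convergence of its integral at almost every
    point. *)
Lemma integrable_convolution_integrand : (mu \x mu)%E.-integrable setT
  (fun z => (k (z.1 - z.2) * f z.2)%:E).
Proof.
apply/integrable21ltyP.
  by apply/measurable_EFinP; exact: measurable_convolution_integrand.
rewrite convolution_tonelli.
exact: mule_L1_lty.
Qed.

Definition convolution (x : R) : R := \int[mu]_t (k (x - t) * f t).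

Lemma measurable_convolution :
  measurable_fun [set: measurableTypeR R] convolution.
Proof.
apply: measurableT_comp => //.
exact: measurable_fubini_F integrable_convolution_integrand.
Qed.

Lemma ae_integrable_convolution :
  {ae mu, forall x, mu.-integrable setT (fun t => (k (x - t) * f t)%:E)}.
Proof. exact: ae_integrable1 integrable_convolution_integrand. Qed.

(** The absolute value goes inside the inner integral, and Tonelli's theorem exchanges the order of
    integration to reach [convolution_tonelli]. *)
Lemma convolution_L1_bound :
  (\int[mu]_x `|(convolution x)%:E| <=
   (\int[mu]_x `|(k x)%:E|) * (\int[mu]_x `|(f x)%:E|))%E.
Proof.
have mc := measurable_convolution_integrand.
rewrite -convolution_tonelli.
have /= <- := @fubini_tonelli _ _ _ _ R mu mu
  (fun z => `|k (z.1 - z.2) * f z.2|%:E).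
- apply: ge0_le_integral => //.
  + do 2 apply: measurableT_comp => //.
    exact: measurable_convolution.
  + pose g (z : measurableTypeR R * measurableTypeR R) :=
      (`|k (z.1 - z.2) * f z.2|%:E : \bar R).
    have mg : measurable_fun setT g by do 2 apply: measurableT_comp => //.
    have g0 z : (0 <= g z)%E by rewrite lee_fin.
    exact: (measurable_fun_fubini_tonelli_F g mg g0).
  + move=> x _; rewrite /convolution /Rintegral.
    set I := (\int[mu]_t (k (x - t) * f t)%:E)%E.
    (* [convolution x] is [fine I], which is [0] when [I] is infinite, so the inequality holds at
       every [x]. *)
    apply: (@le_trans _ _ `|I|%E); first by case: I => //=; rewrite normr0 leey.
    apply: le_abse_integral => //; apply/measurable_EFinP.
    exact: (measurableT_comp mc (pair1_measurable x)).
- by do 2 apply: measurableT_comp => //.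
- by move=> z; rewrite lee_fin.
Qed.

Lemma integrable_convolution : mu.-integrable setT (EFin \o convolution).
Proof.
apply/integrableP; split.
  by apply/measurable_EFinP; exact: measurable_convolution.
apply: le_lt_trans convolution_L1_bound _.
exact: mule_L1_lty.
Qed.

End convolution.

(** * Joint measurability of powers, and indicators as cut-offs *)

Lemma measurable_fun_powR d (T : measurableType d) (R : realType)
    (f g : T -> R) : measurable_fun setT f -> measurable_fun setT g ->
  measurable_fun setT (fun x => f x `^ g x).
Proof.
(* By definition the power is [exp (g ln f)] except where the base is [0], so measurability is
   checked on the test and on both branches. *)
move=> mf mg; rewrite /powR; apply: measurable_fun_ifT.
- exact: measurable_fun_eqr.
- apply: measurableT_comp => //; apply: measurableT_comp => //.
  exact: measurable_fun_eqr.
- apply: measurableT_comp => //; apply: measurable_funM => //.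
  exact: measurableT_comp.
Qed.

Lemma integral_indicM d (T : measurableType d) (R : realType)
    (mu : {measure set T -> \bar R}) (A : set T) (f : T -> R) :
  (\int[mu]_x (\1_A x * f x)%:E = \int[mu]_(x in A) (f x)%:E)%E.
Proof.
rewrite [RHS]integral_mkcond; apply: eq_integral => x _.
by rewrite patchE indicE; case: (x \in A); rewrite ?mul1r// mul0r.
Qed.

(** * The Gamma function and the decay of [P(s, x)] in [s] *)

Section special_functions.
Context {R : realType}.
Local Notation mu := (@lebesgue_measure R).
Implicit Types s t x : R.

(** With [A] encoded as an indicator factor, this is a section integral over the whole line,
    measurable in the parameter by Tonelli's theorem; [fine] preserves measurability. *)
Lemma measurable_parameterized_Rintegral (A : set (measurableTypeR R))
    (g : measurableTypeR R * measurableTypeR R -> R) :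
  measurable A -> measurable_fun setT g -> (forall z, 0 <= g z) ->
  measurable_fun [set: measurableTypeR R]
    (fun s => \int[mu]_(t in A) g (s, t)).
Proof.
move=> mA mg g0.
pose h (z : measurableTypeR R * measurableTypeR R) := (\1_A z.2 * g z)%:E.
have mh : measurable_fun setT h.
  apply: measurableT_comp => //; apply: measurable_funM => //.
  exact: (measurableT_comp (measurable_indic mA) measurable_snd).
have h0 z : (0 <= h z)%E by rewrite lee_fin mulr_ge0.
rewrite (_ : (fun s => _) = fine \o fubini_F mu h).
  apply: measurableT_comp => //.
  exact: (measurable_fun_fubini_tonelli_F h mh h0).
by apply/funext => s; rewrite /Rintegral/= /fubini_F -integral_indicM.
Qed.

Let gamma_integrand s t := t `^ (s - 1) * expR (- t).

Let gamma_integrand_ge0 s t : 0 <= gamma_integrand s t.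
Proof. by rewrite mulr_ge0 ?powR_ge0 ?expR_ge0. Qed.

Let measurable_gamma_integrand2 :
  measurable_fun setT (fun z : measurableTypeR R * measurableTypeR R =>
    gamma_integrand z.1 z.2).
Proof.
apply: measurable_funM.
- apply: measurable_fun_powR; first exact: measurable_snd.
  by apply: measurable_funB => //; exact: measurable_fst.
- by do 2 apply: measurableT_comp => //.
Qed.

Let measurable_gamma_integrand s D : measurable_fun D (gamma_integrand s).
Proof.
apply: measurable_funTS.
exact: (measurableT_comp measurable_gamma_integrand2 (pair1_measurable s)).
Qed.

Lemma Gamma_ge0 s : 0 <= Gamma s.
Proof.
by apply: fine_ge0; apply: integral_ge0 => t _; exact: gamma_integrand_ge0.
Qed.

Lemma measurable_Gamma : measurable_fun [set: measurableTypeR R] (@Gamma R).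
Proof.
apply: (@measurable_parameterized_Rintegral _
  (fun z => gamma_integrand z.1 z.2)) => //.
Qed.

Lemma measurable_Gamma_inv :
  measurable_fun [set: measurableTypeR R] (fun s => (Gamma s)^-1).
Proof.
(* As [Gamma] is nonnegative, its inverse is the power [-1], to which joint measurability of powers
   applies. *)
under eq_fun do rewrite -(powR_inv1 (Gamma_ge0 _)).
by apply: measurable_fun_powR; first exact: measurable_Gamma.
Qed.

Lemma regularized_lower_Gamma_ge0 s x : 0 <= regularized_lower_Gamma s x.
Proof.
rewrite mulr_ge0 ?invr_ge0 ?Gamma_ge0//.
by apply: fine_ge0; apply: integral_ge0 => t _; exact: gamma_integrand_ge0.
Qed.

(** [Gamma s] is the [fine] of an extended integral, and [fine] sends infinite values to [0]; a
    nonzero value therefore certifies convergence. *)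
Let gamma_integral_fin_num s : Gamma s != 0 ->
  (\int[mu]_(t in `]0%R, +oo[) (gamma_integrand s t)%:E)%E \is a fin_num.
Proof.
rewrite /Gamma /Rintegral -/(gamma_integrand _).
by case: (\int[mu]_(t in _) _)%E => //=; rewrite eqxx.
Qed.

Let lower_gamma_le s x :
  (\int[mu]_(t in `]0%R, x[) (gamma_integrand s t)%:E <=
   \int[mu]_(t in `]0%R, +oo[) (gamma_integrand s t)%:E)%E.
Proof.
apply: ge0_subset_integral => //.
- by apply/measurable_EFinP; exact: measurable_gamma_integrand.
- by move=> t _; exact: gamma_integrand_ge0.
- by move=> t /=; rewrite !in_itv/= => /andP[->].
Qed.

Let lower_gamma_fin_num s x : Gamma s != 0 ->
  (\int[mu]_(t in `]0%R, x[) (gamma_integrand s t)%:E)%E \is a fin_num.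
Proof.
move=> /gamma_integral_fin_num; rewrite !ge0_fin_numE.
- exact: le_lt_trans (lower_gamma_le s x).
- by apply: integral_ge0 => t _; exact: gamma_integrand_ge0.
- by apply: integral_ge0 => t _; exact: gamma_integrand_ge0.
Qed.

(* If the integral defining [Gamma s] diverges, then [Gamma s] is [0] and both
   sides vanish, so that no convergence proof is needed. *)
Lemma regularized_lower_GammaE s x :
  (\int[mu]_(t in `]0%R, x[) (t `^ (s - 1) / Gamma s * expR (- t))%:E =
   (regularized_lower_Gamma s x)%:E)%E.
Proof.
under eq_integral do rewrite mulrAC mulrC.
rewrite -/(gamma_integrand _) /regularized_lower_Gamma.
have [->|s0] := eqVneq (Gamma s) 0.
  by under eq_integral do rewrite invr0 mul0r; rewrite integral0 invr0 mul0r.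
under eq_integral do rewrite EFinM.
rewrite ge0_integralZl//.
- by rewrite EFinM fineK// lower_gamma_fin_num.
- by apply/measurable_EFinP; exact: measurable_gamma_integrand.
- by move=> t _; exact: gamma_integrand_ge0.
- by rewrite lee_fin invr_ge0 Gamma_ge0.
Qed.

(** The first term serves [s <= 1], where [P(s, x) <= 1 <= exp(1 - s)]; the second is the constant
    of the bound for [s >= 1]. Their sum covers both ranges. *)
Let C x := expR 1 + x * expR (expR 1 * x + 2).

Lemma regularized_lower_Gamma_le1 s x : regularized_lower_Gamma s x <= 1.
Proof.
rewrite /regularized_lower_Gamma.
have [->|s0] := eqVneq (Gamma s) 0; first by rewrite invr0 mul0r ler01.
have G0 : 0 < Gamma s by rewrite lt_def s0 Gamma_ge0.
rewrite ler_pdivrMl// mulr1 fine_le//; last exact: lower_gamma_le.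
- exact: lower_gamma_fin_num.
- exact: gamma_integral_fin_num.
Qed.

(* For [s >= 1], the integrand of [Gamma s] on [[e x, e x + 1]] is at least
   [(e x)^(s-1) exp(-e x - 1)], whereas on [[0, x]] it is at most [x^(s-1)]. *)
Lemma regularized_lower_Gamma_ge1_bound s x : 0 < x -> 1 <= s ->
  regularized_lower_Gamma s x <= x * expR (expR 1 * x + 2) * expR (- s).
Proof.
move=> x0 s1; have s10 : 0 <= s - 1 by rewrite subr_ge0.
rewrite /regularized_lower_Gamma.
have [->|s0] := eqVneq (Gamma s) 0.
  by rewrite invr0 mul0r !mulr_ge0 ?expR_ge0// ltW.
have G0 : 0 < Gamma s by rewrite lt_def s0 Gamma_ge0.
set y := expR 1 * x; have y0 : 0 < y by rewrite mulr_gt0 ?expR_gt0.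
have GE : y `^ (s - 1) * expR (- (y + 1)) <= Gamma s.
  rewrite -lee_fin fineK ?gamma_integral_fin_num//.
  apply: (@le_trans _ _ (\int[mu]_(t in `[y, (y + 1)%R])
      (y `^ (s - 1) * expR (- (y + 1)))%:E)%E).
    rewrite integral_cst//= lebesgue_measure_itv/= lte_fin ltrDl ltr01.
    by rewrite -EFinB addrAC subrr add0r mule1.
  apply: (@le_trans _ _ (\int[mu]_(t in `[y, (y + 1)%R])
      (gamma_integrand s t)%:E)%E).
    apply: ge0_le_integral => //.
    - by move=> t _; rewrite lee_fin mulr_ge0 ?powR_ge0 ?expR_ge0.
    - by apply/measurable_EFinP; exact: measurable_gamma_integrand.
    - move=> t /=; rewrite in_itv/= => /andP[yt ty]; rewrite lee_fin.
      rewrite ler_pM ?powR_ge0 ?expR_ge0 ?ler_expR ?lerN2//.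
      by rewrite ge0_ler_powR// nnegrE ?(ltW y0)// (le_trans _ yt)// ltW.
  apply: ge0_subset_integral => //.
  - by apply/measurable_EFinP; exact: measurable_gamma_integrand.
  - by move=> t _; exact: gamma_integrand_ge0.
  - move=> t /=; rewrite !in_itv/= andbT => /andP[+ _].
    exact: lt_le_trans.
have PE : fine (\int[mu]_(t in `]0%R, x[) (gamma_integrand s t)%:E)%E <=
    x `^ (s - 1) * x.
  rewrite -lee_fin fineK ?lower_gamma_fin_num//.
  apply: (@le_trans _ _ (\int[mu]_(t in `]0%R, x[) (x `^ (s - 1))%:E)%E).
    apply: ge0_le_integral => //.
    - by move=> t _; exact: gamma_integrand_ge0.
    - by apply/measurable_EFinP; exact: measurable_gamma_integrand.
    - move=> t /=; rewrite in_itv/= => /andP[t0 tx]; rewrite lee_fin.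
      rewrite -[leRHS]mulr1 ler_pM ?powR_ge0 ?expR_ge0//.
      + by rewrite ge0_ler_powR// ?nnegrE ltW.
      + by rewrite -expR0 ler_expR oppr_le0 ltW.
  by rewrite integral_cst//= lebesgue_measure_itv/= lte_fin x0 -EFinB subr0.
rewrite ler_pdivrMl//; apply: (le_trans PE).
apply: (@le_trans _ _ (y `^ (s - 1) * expR (- (y + 1)) *
    (x * expR (y + 2) * expR (- s)))); last first.
  by rewrite ler_wpM2r// !mulr_ge0 ?expR_ge0// ltW.
(* The choice [y = e x] releases the factor [exp(s - 1)], the source of the decay in [s]. The
   constant [exp(y + 2)] is what makes all the exponentials cancel below. *)
have -> : y `^ (s - 1) = expR (s - 1) * x `^ (s - 1).
  rewrite /y powRM ?expR_ge0 ?(ltW x0)//.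
  by rewrite {1}/powR gt_eqF ?expR_gt0// expRK mulr1.
have -> : expR (s - 1) * x `^ (s - 1) * expR (- (y + 1)) *
    (x * expR (y + 2) * expR (- s)) =
    x `^ (s - 1) * x *
    (expR (s - 1) * expR (- (y + 1)) * expR (y + 2) * expR (- s)).
  by ring.
rewrite -!expRD (_ : s - 1 - (y + 1) + (y + 2) - s = 0) ?expR0 ?mulr1//.
by ring.
Qed.

Lemma regularized_lower_Gamma_expR_bound s x : 0 < x ->
  regularized_lower_Gamma s x <= C x * expR (- s).
Proof.
move=> x0; rewrite /C mulrDl -expRD.
have [s1|/ltW s1] := leP 1 s.
  rewrite (le_trans (regularized_lower_Gamma_ge1_bound _ _ x0 s1))// lerDr.
  exact: expR_ge0.
rewrite (le_trans (regularized_lower_Gamma_le1 _ _))//.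
apply: (@le_trans _ _ (expR (1 - s))).
  by rewrite -[X in X <= _]expR0 ler_expR subr_ge0.
by rewrite lerDl !mulr_ge0 ?expR_ge0// ltW.
Qed.

Lemma measurable_regularized_lower_Gamma x :
  measurable_fun [set: measurableTypeR R]
    (fun s => regularized_lower_Gamma s x).
Proof.
apply: measurable_funM; first exact: measurable_Gamma_inv.
apply: (@measurable_parameterized_Rintegral _
  (fun z => gamma_integrand z.1 z.2)) => //.
Qed.

(** The integrand is dominated by [C x] times the exponential density of rate [1], whose integral is
    [1]. *)
Lemma integral_regularized_lower_Gamma_lty x : 0 < x ->
  (\int[mu]_(s in `]0%R, +oo[) (regularized_lower_Gamma s x)%:E < +oo)%E.
Proof.
move=> x0; have C0 : 0 <= C x by rewrite addr_ge0 ?mulr_ge0 ?expR_ge0// ltW.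
have mp : measurable_fun setT (EFin \o exponential_pdf (1 : R)).
  by apply/measurable_EFinP; exact: measurable_exponential_pdf.
have p0 s : (0 <= (exponential_pdf (1 : R) s)%:E)%E.
  by rewrite lee_fin exponential_pdf_ge0.
apply: (@le_lt_trans _ _
    ((C x)%:E * \int[mu]_s (exponential_pdf 1 s)%:E)%E); last first.
  by rewrite integral_exponential_pdf// mule1 ltry.
rewrite -ge0_integralZl//.
rewrite -integral_indicM; apply: ge0_le_integral => //.
- by move=> s _; rewrite lee_fin mulr_ge0// regularized_lower_Gamma_ge0.
- apply/measurable_EFinP; apply: measurable_funM; first exact: measurable_indic.
  exact: measurable_regularized_lower_Gamma.
- by apply: measurable_funeM.
move=> s _; rewrite indicE; case: (boolP (s \in _)) => [|_]; last first.
  by rewrite mul0r mule_ge0.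
rewrite inE/= in_itv/= andbT mul1r => s0.
rewrite exponential_pdfE ?(ltW s0)// -EFinM lee_fin mulN1r mul1r.
exact: regularized_lower_Gamma_expR_bound.
Qed.

(** * The kernel of second kind and its integral *)

Let kernel_integrand t s := t `^ (s - 1) / Gamma s.

Let kernel_integrand_ge0 t s : 0 <= kernel_integrand t s.
Proof. by rewrite mulr_ge0 ?powR_ge0 ?invr_ge0 ?Gamma_ge0. Qed.

Let measurable_kernel_integrand2 :
  measurable_fun setT (fun z : measurableTypeR R * measurableTypeR R =>
    kernel_integrand z.1 z.2).
Proof.
apply: measurable_funM.
- apply: measurable_fun_powR; first exact: measurable_fst.
  by apply: measurable_funB => //; exact: measurable_snd.
- exact: (measurableT_comp measurable_Gamma_inv measurable_snd).
Qed.

Lemma kernel_second_kind_ge0 t : 0 <= kernel_second_kind t.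
Proof.
rewrite mulr_ge0 ?expR_ge0//; apply: fine_ge0; apply: integral_ge0 => s _.
exact: kernel_integrand_ge0.
Qed.

Lemma measurable_kernel_second_kind :
  measurable_fun [set: measurableTypeR R] (@kernel_second_kind R).
Proof.
apply: measurable_funM; first by do 2 apply: measurableT_comp => //.
by apply: (@measurable_parameterized_Rintegral _
  (fun z => kernel_integrand z.1 z.2)).
Qed.

(* An inequality suffices, and it avoids proving that the integral defining
   [kernel_second_kind t] converges: where it diverges the kernel is [0]. *)
Lemma integral_kernel_second_kind_le x :
  (\int[mu]_(t in `]0%R, x]) (kernel_second_kind t)%:E <=
   \int[mu]_(s in `]0%R, +oo[) (regularized_lower_Gamma s x)%:E)%E.
Proof.
pose A := `]0%R, x]%classic : set R; pose B := `]0%R, +oo[%classic : set R.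
have mA : measurable A by exact: measurable_itv.
have mB : measurable B by exact: measurable_itv.
(* Both domains of integration become indicator factors, so that Tonelli's theorem applies on the
   whole plane. *)
pose g t s := \1_A t * (\1_B s * (kernel_integrand t s * expR (- t))).
have g0 t s : 0 <= g t s.
  do 2 apply: mulr_ge0 => //.
  by apply: mulr_ge0; [exact: kernel_integrand_ge0|exact: expR_ge0].
have mg2 : measurable_fun setT
    (fun z : measurableTypeR R * measurableTypeR R => (g z.1 z.2)%:E).
  apply: measurableT_comp => //; apply: measurable_funM.
    exact: (measurableT_comp (measurable_indic mA) measurable_fst).
  apply: measurable_funM.
    exact: (measurableT_comp (measurable_indic mB) measurable_snd).
  apply: measurable_funM => //.
  by do 2 apply: measurableT_comp => //.
have g20 (z : measurableTypeR R * measurableTypeR R) : (0 <= (g z.1 z.2)%:E)%E.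
  by rewrite lee_fin g0.
apply: (@le_trans _ _ (\int[mu]_t \int[mu]_s (g t s)%:E)%E).
  rewrite -integral_indicM; apply: ge0_le_integral => //.
  - by move=> t _; rewrite lee_fin mulr_ge0// kernel_second_kind_ge0.
  - apply: measurableT_comp => //; apply: measurable_funM.
      exact: measurable_indic.
    exact: measurable_kernel_second_kind.
  - exact: (measurable_fun_fubini_tonelli_F _ mg2 g20).
  move=> t _; rewrite /g.
  have [tA|tA] := boolP (t \in A); last first.
    rewrite indicE (negbTE tA) mul0r integral_ge0// => s _.
    by rewrite lee_fin mul0r.
  rewrite indicE tA mul1r.
  under eq_integral do rewrite mul1r.
  rewrite integral_indicM.
  under eq_integral do rewrite mulrC EFinM.
  rewrite ge0_integralZl//; last 2 first.
  - apply: measurableT_comp => //; apply: measurable_funTS.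
    exact: (measurableT_comp measurable_kernel_integrand2 (pair1_measurable t)).
  - by move=> s _; exact: kernel_integrand_ge0.
  rewrite /kernel_second_kind EFinM lee_wpmul2l ?lee_fin ?expR_ge0// /Rintegral.
  rewrite -/(kernel_integrand t).
  have : (0 <= \int[mu]_(s in B) (kernel_integrand t s)%:E)%E.
    by apply: integral_ge0 => s _; rewrite lee_fin.
  by rewrite /B; case: (\int[mu]_(s in _) _)%E => //= _; rewrite leey.
(* With the order exchanged, the inner integral over [t] is the one that [regularized_lower_GammaE]
   evaluates to [P(s, x)]. *)
have -> := fubini_tonelli (m1 := mu) (m2 := mu) _ mg2 g20.
rewrite -integral_indicM le_eqVlt; apply/orP; left; apply/eqP.
apply: eq_integral => s _; rewrite /g /=.
have mgs : measurable_fun [set: measurableTypeR R]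
    (fun t => kernel_integrand t s * expR (- t)).
  apply: measurable_funM; last by do 2 apply: measurableT_comp => //.
  exact: (measurableT_comp measurable_kernel_integrand2 (pair2_measurable s)).
under eq_integral do rewrite mulrCA EFinM.
rewrite ge0_integralZl//; last 2 first.
- apply: measurableT_comp => //; apply: measurable_funM.
    exact: measurable_indic.
  exact: mgs.
- move=> t _; rewrite lee_fin; apply: mulr_ge0 => //.
  by apply: mulr_ge0; [exact: kernel_integrand_ge0|exact: expR_ge0].
(* The endpoint [x] is a null set; dropping it matches the open interval in the definition of
   [P]. *)
rewrite integral_indicM /A -integral_itv_bndo_bndc//; last first.
  apply: measurableT_comp => //; apply: measurable_funTS.
  exact: mgs.
by rewrite regularized_lower_GammaE.
Qed.

End special_functions.

(** * The operator on measurable functions, as a convolution *)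

Section second_kind_operator.
Context {R : realType} (alpha a b : R).
Hypotheses (alpha_gt0 : 0 < alpha) (a_lt_b : a < b).
Local Notation mu := (@lebesgue_measure R).
Let M := (b - a) / alpha.

Let M_gt0 : 0 < M. Proof. by rewrite divr_gt0// subr_gt0. Qed.

(** The cut-off bears on [u / alpha], so that the whole function is a rescaling of a single one. It
    keeps every difference [x - t] with [a <= t < x <= b]. *)
Definition truncated_kernel (u : R) : R :=
  \1_(`]0, M]%classic : set R) (u / alpha) * kernel_second_kind (u / alpha).

Lemma truncated_kernel_ge0 u : 0 <= truncated_kernel u.
Proof. by rewrite mulr_ge0// kernel_second_kind_ge0. Qed.

Let measurable_cut_kernel : measurable_fun [set: measurableTypeR R]
  (fun u => \1_(`]0, M]%classic : set R) u * kernel_second_kind u).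
Proof.
apply: measurable_funM; first exact: measurable_indic.
exact: measurable_kernel_second_kind.
Qed.

Lemma measurable_truncated_kernel :
  measurable_fun [set: measurableTypeR R] truncated_kernel.
Proof.
apply: (measurableT_comp measurable_cut_kernel
  (_ : measurable_fun [set: measurableTypeR R] (fun u : R => u / alpha))).
exact: measurable_funM.
Qed.

(** The substitution [u = alpha v] produces the factor [alpha] and leaves the integral of the kernel
    over []0, M]]. *)
Lemma integral_truncated_kernel_le :
  (\int[mu]_u `|(truncated_kernel u)%:E| <= (alpha * \int[mu]_(s in `]0%R, +oo[)
     regularized_lower_Gamma s M)%:E)%E.
Proof.
under eq_integral do rewrite gee0_abs ?lee_fin ?truncated_kernel_ge0//.
pose h (u : R) := (\1_(`]0, M]%classic : set R) u * kernel_second_kind u)%:E.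
rewrite (eq_integral
  (fun u : measurableTypeR R => h (((u : R) - 0) / alpha))); last first.
  by move=> u _; rewrite subr0.
rewrite ge0_integral_affine//; last 2 first.
- by apply/measurable_EFinP; exact: measurable_cut_kernel.
- by move=> u; rewrite lee_fin mulr_ge0// kernel_second_kind_ge0.
rewrite integral_indicM EFinM; apply: lee_wpmul2l; first by rewrite lee_fin ltW.
(* The bound is stated with a real integral; convergence of the integral of [P(s, M)] identifies it
   with the extended one. *)
rewrite fineK; last first.
  rewrite ge0_fin_numE ?integral_regularized_lower_Gamma_lty//.
  by apply: integral_ge0 => s _; rewrite lee_fin regularized_lower_Gamma_ge0.
exact: integral_kernel_second_kind_le.
Qed.

Lemma integrable_truncated_kernel :
  mu.-integrable setT (EFin \o truncated_kernel).
Proof.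
apply/integrableP; split.
  by apply/measurable_EFinP; exact: measurable_truncated_kernel.
exact: le_lt_trans integral_truncated_kernel_le (ltry _).
Qed.

Let cut (f : R -> R) (t : R) : R := \1_(`[a, b]%classic : set R) t * f t.

(** The two indicators multiply to that of [[a, x[]: positivity of [x - t] gives [t < x], and
    conversely [a <= t < x <= b] implies [t <= b] and [x - t <= b - a]. *)
Lemma truncated_kernel_left_integrand (f : R -> R) x t : a <= x <= b ->
  truncated_kernel (x - t) * cut f t =
  \1_(`[a, x[%classic : set R) t * left_integrand alpha f x t.
Proof.
move=> /andP[ax xb]; rewrite /truncated_kernel /cut /left_integrand.
rewrite mulrACA; congr (_ * _).
rewrite !indicE !mem_setE !in_itv/= /M.
rewrite pmulr_lgt0 ?invr_gt0// subr_gt0 ler_pM2r ?invr_gt0// -natrM mulnb.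
congr (nat_of_bool _)%:R; apply/andP/andP => -[].
  by move=> /andP[tx _] /andP[at_ _].
move=> at_ tx; rewrite tx at_ lerB// (le_trans _ xb)//; exact: ltW.
Qed.

Let cutE (f : R -> R) :
  EFin \o cut f = (EFin \o f) \_ `[a, b].
Proof.
apply/funext => t; rewrite /= /cut patchE indicE.
by case: (t \in _); rewrite ?mul1r// mul0r.
Qed.

Section operator_on_function.
Variable f : R -> R.
Hypothesis mf : measurable_fun setT f.
Hypothesis intf : mu.-integrable `[a, b] (EFin \o f).

Let mcut : measurable_fun setT (cut f).
Proof. by apply: measurable_funM => //; exact: measurable_indic. Qed.

Let icut : mu.-integrable setT (EFin \o cut f).
Proof.
by rewrite cutE; apply/(integrable_mkcond _ _).1 => //; exact: measurable_itv.
Qed.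

Let mk := measurable_truncated_kernel.
Let ik := integrable_truncated_kernel.

Definition second_kind_function := convolution truncated_kernel (cut f).

Lemma measurable_second_kind_function :
  measurable_fun [set: measurableTypeR R] second_kind_function.
Proof. exact: measurable_convolution. Qed.

Lemma integrable_second_kind_function :
  mu.-integrable `[a, b] (EFin \o second_kind_function).
Proof.
apply: (@integrableS _ _ _ mu setT) => //.
exact: integrable_convolution.
Qed.

Lemma second_kind_functionE x : a <= x <= b ->
  second_kind_function x = left_fractional_integral alpha a f x.
Proof.
move=> axb; rewrite /second_kind_function /convolution.
rewrite /left_fractional_integral /Rintegral -[in RHS]integral_indicM.
congr fine; apply: eq_integral => t _.
by rewrite truncated_kernel_left_integrand.
Qed.

(** Linearity will need additivity of the integral, hence convergence, which Fubini's theorem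
    provides for almost every [x]. *)
Lemma ae_integrable_left_integrand :
  {ae mu, forall x, a <= x <= b ->
    mu.-integrable `[a, x[ (fun t => (left_integrand alpha f x t)%:E)}.
Proof.
have := ae_integrable_convolution _ _ mk mcut ik icut.
apply: (@filterS _ _ (ae_filter_ringOfSetsType mu)) => x ix axb.
apply/integrable_mkcond => //.
apply: eq_integrable ix => // t _.
rewrite truncated_kernel_left_integrand// patchE indicE.
by case: (t \in _); rewrite ?mul1r// mul0r.
Qed.

Lemma second_kind_function_bound :
  (\int[mu]_(x in `[a, b]) `|(second_kind_function x)%:E| <=
    (alpha * \int[mu]_(s in `]0%R, +oo[) regularized_lower_Gamma s M)%:E *
    \int[mu]_(x in `[a, b]) `|(f x)%:E|)%E.
Proof.
have mabs : measurable_fun [set: measurableTypeR R]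
    (fun x => `|(second_kind_function x)%:E|%E).
  by do 2 apply: measurableT_comp => //; exact: measurable_second_kind_function.
(* Young's inequality concerns the whole line; enlarging the domain only increases the integral of
   an absolute value. *)
apply: (@le_trans _ _ (\int[mu]_x `|(second_kind_function x)%:E|)%E).
  exact: ge0_subset_integral.
apply: (le_trans (convolution_L1_bound _ _ mk mcut ik icut)).
have -> : (\int[mu]_x `|(cut f x)%:E| = \int[mu]_(x in `[a, b]) `|(f x)%:E|)%E.
  rewrite [RHS]integral_mkcond; apply: eq_integral => t _.
  rewrite patchE /cut indicE.
  by case: (t \in _); rewrite ?mul1r// mul0r abse0.
apply: lee_wpmul2r; first exact: integral_ge0.
exact: integral_truncated_kernel_le.
Qed.

End operator_on_function.

End second_kind_operator.

(** * Passage to classes in L^1([a, b]) *)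

Section second_kind_L1.
Context {R : realType} (alpha a b : R).
Hypotheses (alpha_gt0 : 0 < alpha) (a_lt_b : a < b).
Local Notation mu := (@lebesgue_measure R).
Local Notation muab := (mrestr mu (measurable_itv `[a, b]) :
  {measure set (measurableTypeR R) -> \bar R}).
Local Notation S := (second_kind_function alpha a b).
Local Notation norm_const := (alpha * \int[mu]_(s in `]0%R, +oo[)
  regularized_lower_Gamma s ((b - a) / alpha)).

Lemma L1_measurable (f : L1 a b) :
  measurable_fun [set: measurableTypeR R] (f : R -> R).
Proof. by have /andP[+ _] := Lspace_Lfun f; rewrite inE. Qed.

Lemma L1_integrable (f : L1 a b) :
  mu.-integrable `[a, b] (EFin \o (f : R -> R)).
Proof.
have mf : measurable_fun [set: measurableTypeR R] (EFin \o (f : R -> R)).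
  by apply/measurable_EFinP; exact: L1_measurable.
apply: ((integrable_mrestr _ _ _ mu _ (measurable_itv `[a, b]) _ mf).1).
by apply/Lfun1_integrable; exact: Lspace_Lfun.
Qed.

Lemma second_kind_Lfun (f : L1 a b) : S f \in Lfun muab 1.
Proof.
apply/Lfun1_integrable.
apply: ((integrable_mrestr _ _ _ mu _ (measurable_itv `[a, b]) _ _).2).
- apply/measurable_EFinP; apply: measurable_second_kind_function => //.
  + exact: L1_measurable.
  + exact: L1_integrable.
- apply: integrable_second_kind_function => //.
  + exact: L1_measurable.
  + exact: L1_integrable.
Qed.

Definition second_kind_L1 (f : L1 a b) : L1 a b :=
  Lspace_class (Lfun_Sub (@lexx _ _ 1%E) (second_kind_Lfun f)).

(** A class is read through a chosen representative, which agrees with the convolution only almost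
    everywhere on [[a, b]]. *)
Lemma second_kind_L1E (f : L1 a b) :
  {ae mu, forall x, a <= x <= b ->
    second_kind_L1 f x = left_fractional_integral alpha a f x}.
Proof.
have /ae_mrestr :=
  Lspace_classE (Lfun_Sub (@lexx _ _ 1%E) (second_kind_Lfun f)).
apply: (@filterS _ _ (ae_filter_ringOfSetsType mu)) => x fx axb.
by rewrite /second_kind_L1 fx//=; exact: second_kind_functionE.
Qed.

Lemma measurable_left_integrand (f : R -> R) x :
  measurable_fun [set: measurableTypeR R] f ->
  measurable_fun [set: measurableTypeR R] (left_integrand alpha f x).
Proof.
move=> mf; apply: measurable_funM => //.
apply: (measurableT_comp measurable_kernel_second_kind
  (_ : measurable_fun [set: measurableTypeR R] (fun t : R => (x - t) / alpha))).
by apply: measurable_funM => //; exact: measurable_funB.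
Qed.

(** The relation between [h], [f] and [g] is only almost everywhere because [h] will be the
    representative of the class [c *: f + g]. *)
Lemma left_fractional_integral_linear c (f g h : R -> R) x :
  measurable_fun [set: measurableTypeR R] f ->
  measurable_fun [set: measurableTypeR R] g ->
  measurable_fun [set: measurableTypeR R] h ->
  {ae mu, forall t, a <= t < x -> h t = c * f t + g t} ->
  mu.-integrable `[a, x[ (fun t => (left_integrand alpha f x t)%:E) ->
  mu.-integrable `[a, x[ (fun t => (left_integrand alpha g x t)%:E) ->
  left_fractional_integral alpha a h x =
  c * left_fractional_integral alpha a f x +
  left_fractional_integral alpha a g x.
Proof.
move=> mf mg mh hE fi gi; rewrite /left_fractional_integral.
have cfi : mu.-integrable `[a, x[
    (EFin \o (fun t => c * left_integrand alpha f x t)).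
  have : mu.-integrable `[a, x[
      (fun t => c%:E * (left_integrand alpha f x t)%:E)%E.
    exact: integrableZl.
  by [].
rewrite -RintegralZl// -RintegralD//=.
congr fine; apply: ae_eq_integral => //.
- apply/measurable_EFinP; apply: measurable_funTS.
  exact: measurable_left_integrand.
- apply/measurable_EFinP; apply: measurable_funTS; apply: measurable_funD.
    by apply: measurable_funM => //; exact: measurable_left_integrand.
  exact: measurable_left_integrand.
- apply: (@filterS _ _ (ae_filter_ringOfSetsType mu)) hE => t ht /=.
  by rewrite in_itv/= => tx; rewrite /left_integrand ht// mulrDr mulrCA.
Qed.

Lemma second_kind_L1_linear : linear second_kind_L1.
Proof.
move=> c f g; apply: LspaceP; apply/ae_mrestr.
have cfgE : ((c *: f + g : L1 a b) : R -> R) =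
    (c \*: (f : R -> R) \+ (g : R -> R)) %[ae muab].
  apply: filterS2 (Lspace_addE (c *: f) g) (Lspace_scaleE c f) => x h1 h2 _.
  by rewrite h1//= h2.
have ScfgE : ((c *: second_kind_L1 f + second_kind_L1 g : L1 a b) : R -> R) =
    (c \*: (second_kind_L1 f : R -> R) \+ (second_kind_L1 g : R -> R))
    %[ae muab].
  apply: filterS2 (Lspace_addE (c *: second_kind_L1 f) (second_kind_L1 g))
    (Lspace_scaleE c (second_kind_L1 f)) => x h1 h2 _.
  by rewrite h1//= h2.
have iF (u : L1 a b) := ae_integrable_left_integrand alpha a b alpha_gt0 a_lt_b
  u (L1_measurable u) (L1_integrable u).
have FF := ae_filter_ringOfSetsType mu.
move/ae_mrestr : cfgE => cfgE; move/ae_mrestr : ScfgE => ScfgE.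
(* Six conditions of full measure are intersected: convergence for [f] and [g], the integral formula
   for the three images, and the pointwise form of the combination of images. *)
apply: (@filterS _ _ FF _ _ _ (filterI (filterI (iF f) (iF g)) (filterI
  (filterI (second_kind_L1E (c *: f + g)) ScfgE)
  (filterI (second_kind_L1E f) (second_kind_L1E g))))).
move=> x [[ifx igx] [[SE S2E] [SfE SgE]]] axb _; have axb' : a <= x <= b.
  by move: axb; rewrite /= in_itv.
rewrite SE// S2E//= SfE// SgE//.
apply: left_fractional_integral_linear;
  [exact: (L1_measurable f)|exact: (L1_measurable g)|
   exact: (L1_measurable (c *: f + g))| |exact: ifx|exact: igx].
(* The relation known on [[a, b]] restricts to [[a, x[] since [x <= b]. *)
apply: (@filterS _ _ FF) cfgE => t h tx; apply: h => //.
move: tx axb'; rewrite /= in_itv/= => /andP[-> /ltW tx] /andP[_ xb].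
exact: le_trans tx xb.
Qed.

Lemma Lnorm1_mrestr (u : R -> R) :
  measurable_fun [set: measurableTypeR R] u ->
  ('N[muab]_1[EFin \o u] = \int[mu]_(x in `[a, b]) `|(u x)%:E|)%E.
Proof.
move=> mf; rewrite Lnorm1 ge0_integral_mrestr//.
by do 2 apply: measurableT_comp => //.
Qed.

Lemma second_kind_L1_norm (f : L1 a b) :
  `|second_kind_L1 f| <= norm_const * `|f|.
Proof.
have mf := L1_measurable f; have intf := L1_integrable f.
have mS := measurable_second_kind_function _ _ _ alpha_gt0 a_lt_b _ mf intf.
have normf : (`|f|%:E = \int[mu]_(x in `[a, b]) `|((f : R -> R) x)%:E|)%E.
  rewrite -Lnorm1_mrestr// fineK// Lnorm1_mrestr//.
  by have /integrableP[_ fin] := intf; rewrite ge0_fin_numE ?integral_ge0.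
have normS : (`|second_kind_L1 f|%:E = \int[mu]_(x in `[a, b]) `|(S f x)%:E|)%E.
  (* The norm of the class is computed on the convolution itself instead of the chosen
     representative. *)
  rewrite [in LHS]/Num.norm/= Lspace_norm_class/= -Lnorm1_mrestr// fineK//.
  rewrite Lnorm1_mrestr//.
  have /integrableP[_ fin] :=
    integrable_second_kind_function _ _ _ alpha_gt0 a_lt_b _ mf intf.
  by rewrite ge0_fin_numE ?integral_ge0.
by rewrite -lee_fin EFinM normS normf; exact: second_kind_function_bound.
Qed.

End second_kind_L1.

(** * Assembly of the bundled linear operator, its formula, continuity and norm bound *)

Theorem theorem3p1 (R : realType) (alpha a b : R) (alpha_gt0 : 0 < alpha)
    (a_lt_b : a < b) :
  exists Sop : {linear L1 a b -> L1 a b},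
    [/\ forall f : L1 a b,
          {ae @lebesgue_measure R, forall x : R, a <= x <= b ->
            (@lebesgue_measure R).-integrable `[a, x[
              (fun t => (left_integrand alpha f x t)%:E) /\
            Sop f x = left_fractional_integral alpha a f x},
        continuous Sop
      & forall f : L1 a b,
          `|Sop f| <= alpha * (\int[@lebesgue_measure R]_(s in `]0, +oo[)
                       regularized_lower_Gamma s ((b - a) / alpha)) * `|f|].
Proof.
pose S := second_kind_L1 alpha a b alpha_gt0 a_lt_b.
pose Sop : {linear L1 a b -> L1 a b} := HB.pack S
  (GRing.isLinear.Build _ _ _ _ S
    (second_kind_L1_linear alpha a b alpha_gt0 a_lt_b)).
exists Sop; have Sop_bound := second_kind_L1_norm alpha a b alpha_gt0 a_lt_b.
split=> [f||//].
- have iF := ae_integrable_left_integrand alpha a b alpha_gt0 a_lt_b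
    f (L1_measurable a b f) (L1_integrable a b f).
  have SE := second_kind_L1E alpha a b alpha_gt0 a_lt_b f.
  have FF := ae_filter_ringOfSetsType (@lebesgue_measure R).
  apply: (@filterS2 _ _ FF) iF SE => x ifx Sx axb.
  by split; [exact: ifx|exact: Sx].
(* For a linear map continuity follows from boundedness, and every [r] above the constant in
   [Sop_bound] is a bound. *)
- apply: bounded_linear_continuous; apply/linear_boundedP.
  near=> r => f; apply: (le_trans (Sop_bound f)); apply: ler_wpM2r => //.
Unshelve. all: by end_near.
Qed.
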